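(* Let $\Omega\subsetneq\mathbb{R}^{2n+1}$ be a nonempty open convex set (convex in the Euclidean sense; not necessarily bounded). For $\xi\in\Omega$ let $\hat\xi\in\partial\Omega$ be a point with $|\xi-\hat\xi|=\operatorname{dist}(\xi,\partial\Omega)$ and let $\nu(\xi)=(\hat\xi-\xi)/|\hat\xi-\xi|\in\mathbb{S}^{2n}$ (a unit normal to $\partial\Omega$ at $\hat\xi$). Then for every $u\in C_0^\infty(\Omega)$, \[ \int_\Omega|\nabla_{\mathbb{H}^n}u|^2\,d\xi\ge\frac14\int_\Omega\sum_{i=1}^n\frac{\langle X_i(\xi),\nu(\xi)\rangle^2+\langle Y_i(\xi),\nu(\xi)\rangle^2}{\operatorname{dist}(\xi,\partial\Omega)^2}|u|^2\,d\xi . \]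
   Context: $\mathbb{H}^n$ is $\mathbb{R}^{2n+1}$ with points $\xi=(x,y,t)$, $x,y\in\mathbb{R}^n$, $t\in\mathbb{R}$, and Lebesgue measure. For $1\le i\le n$, $X_i=\partial_{x_i}+2y_i\partial_t$, $Y_i=\partial_{y_i}-2x_i\partial_t$, identified with their coefficient vectors in $\mathbb{R}^{2n+1}$; $\langle\cdot,\cdot\rangle$ is the Euclidean inner product. $\nabla_{\mathbb{H}^n}u=(X_1u,\dots,X_nu,Y_1u,\dots,Y_nu)$, $|\nabla_{\mathbb{H}^n}u|^2=\sum_i(|X_iu|^2+|Y_iu|^2)$. $\operatorname{dist}$ is Euclidean distance and $\mathbb{S}^{2n}$ the Euclidean unit sphere. Functions are real-valued. *)

(* Defs.v *)
From HB Require Import structures.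
From mathcomp Require Import all_boot all_order all_algebra.
From mathcomp Require Import all_classical all_reals all_analysis.
Set Implicit Arguments. Unset Strict Implicit. Unset Printing Implicit Defensive.
Import Order.TTheory GRing.Theory Num.Theory.
Import numFieldNormedType.Exports.
Local Open Scope classical_set_scope.
Local Open Scope ring_scope.

Section Heis.
Variable R : realType.

(** Points of H^n = R^(2n+1) are row vectors of size n + n + 1:
    x_i at index i, y_i at index n + i, t at index 2n. *)
Definition dimH (n : nat) : nat := (n + n + 1)%N.
Definition pt (n : nat) := 'rV[R]_(dimH n).

Definition ix n (i : 'I_n) : 'I_(dimH n) := lshift 1 (lshift n i).
Definition iy n (i : 'I_n) : 'I_(dimH n) := lshift 1 (rshift n i).
Definition it n : 'I_(dimH n) := rshift (n + n) (@ord0 0).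

Definition eucl_dot m (a b : 'rV[R]_m) : R := \sum_(j < m) a 0 j * b 0 j.
Definition eucl_dist m (a b : 'rV[R]_m) : R := Num.sqrt (eucl_dot (a - b) (a - b)).

Definition boundary m (A : set 'rV[R]_m) : set 'rV[R]_m :=
  closure A `\` interior A.
Definition dist_set m (x : 'rV[R]_m) (A : set 'rV[R]_m) : R :=
  inf [set eucl_dist x a | a in A].

Definition econvex m (A : set 'rV[R]_m) : Prop :=
  forall a b, A a -> A b -> forall l : R, 0 <= l <= 1 ->
    A (l *: a + (1 - l) *: b).

Fixpoint iterD m (l : seq 'rV[R]_m) (f : 'rV[R]_m -> R) : 'rV[R]_m -> R :=
  match l with
  | [::] => f
  | v :: l' => 'D_v (iterD l' f)
  end.
Definition smooth m (f : 'rV[R]_m -> R) : Prop :=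
  forall l : seq 'rV[R]_m,
    continuous (iterD l f) /\ (forall x v, derivable (iterD l f) x v).

Definition Cc_infty m (Omega : set 'rV[R]_m) (u : 'rV[R]_m -> R) : Prop :=
  smooth u /\ compact (closure [set x | u x != 0]) /\
  closure [set x | u x != 0] `<=` Omega.

(** Lebesgue integral on R^m of a nonnegative function, as iterated
    one-dimensional Lebesgue integrals (Tonelli). *)
Fixpoint leb_int (m : nat) : ('rV[R]_m -> \bar R) -> \bar R :=
  match m return ('rV[R]_m -> \bar R) -> \bar R with
  | 0%N => fun f => f 0
  | m'.+1 => fun f =>
      (\int[@lebesgue_measure R]_x
         leb_int (fun v : 'rV[R]_m' => f (row_mx (\row_(_ < 1) x) v)))%E
  end.

(** Left-invariant vector fields, as coefficient vectors in R^(2n+1) *)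
Definition Xvf n (i : 'I_n) (xi : pt n) : pt n :=
  delta_mx 0 (ix i) + (2 * xi 0 (iy i)) *: delta_mx 0 (it n).
Definition Yvf n (i : 'I_n) (xi : pt n) : pt n :=
  delta_mx 0 (iy i) - (2 * xi 0 (ix i)) *: delta_mx 0 (it n).

Definition Xop n (i : 'I_n) (u : pt n -> R) (xi : pt n) : R :=
  'D_(delta_mx 0 (ix i)) u xi + 2 * xi 0 (iy i) * 'D_(delta_mx 0 (it n)) u xi.
Definition Yop n (i : 'I_n) (u : pt n -> R) (xi : pt n) : R :=
  'D_(delta_mx 0 (iy i)) u xi - 2 * xi 0 (ix i) * 'D_(delta_mx 0 (it n)) u xi.

Definition gradH_sq n (u : pt n -> R) (xi : pt n) : R :=
  \sum_(i < n) (Xop i u xi ^+ 2 + Yop i u xi ^+ 2).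

End Heis.

(* Main.v *)
(** A discrete ground-state argument along the integral lines of each field
V = X_i or V = Y_i, which is constant along its own flow
Phi_s(xi) = xi + s V(xi).  Let d be the distance to the boundary and
psi = sqrt d.  The hyperplane orthogonal to nu(xi) at the nearest boundary point
supports Omega, so d(eta) <= d(xi) - <eta - xi, nu(xi)> on Omega; with
q = h <V(xi), nu(xi)> / d(xi), this and the inequality
sqrt(1 - q) + sqrt(1 + q) <= 2 - q^2/4 give
  (1/4) h^2 <V, nu>^2 / d^2 <= 2 - psi(Phi_h)/psi - psi(Phi_{-h})/psi.
AM-GM with weight psi(Phi_h)/psi and the invariance of Lebesgue measure under
Phi_h give
  int u^2 (2 - psi(Phi_h)/psi - psi(Phi_{-h})/psi) <= int (u(Phi_h) - u)^2,
and the right-hand side divided by h^2 tends to int |V u|^2 as h -> 0.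

The choice of the nearest point may make the weight <V, nu>^2 / d^2
nonmeasurable; it is only ever bounded pointwise by continuous compactly
supported functions, for which the iterated integral is linear. *)
Require Import Defs.
From HB Require Import structures.
From mathcomp Require Import all_boot all_order all_algebra.
From mathcomp Require Import all_classical all_reals all_analysis.
From mathcomp Require Import measurable_realfun ring lra.
Import Order.TTheory GRing.Theory Num.Theory.
Import numFieldNormedType.Exports.
Local Open Scope classical_set_scope.
Local Open Scope ring_scope.

Set Implicit Arguments. Unset Strict Implicit. Unset Printing Implicit Defensive.

(** * Iterated integrals of continuous compactly supported functions *)

Section RowVectors.
Context {R : realType}.

Lemma coord_le_norm m (v : 'rV[R]_m) j : `|v 0 j| <= `|v|.
Proof.
rewrite [leRHS]/Num.norm /= mx_normrE; apply/bigmax_geP; right => /=.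
by exists (ord0, j).
Qed.

Lemma norm_le_coord m (v : 'rV[R]_m) c :
  0 <= c -> (forall j, `|v 0 j| <= c) -> `|v| <= c.
Proof.
move=> c0 vc; rewrite [leLHS]/Num.norm /= mx_normrE; apply/bigmax_leP; split => //.
by move=> [i j] _ /=; rewrite (ord1 i).
Qed.

Lemma rV_cvg (T : Type) (F : set_system T) {FF : Filter F} m
    (g : T -> 'rV[R]_m) (l : 'rV[R]_m) :
  (forall j, g t 0 j @[t --> F] --> l 0 j) -> g t @[t --> F] --> l.
Proof.
move=> gl; apply/cvgrPdist_le => e e0.
have : \forall t \near F, forall j, `|l 0 j - g t 0 j| <= e.
  by apply: filter_forall => j; have /cvgrPdist_le := gl j; apply.
apply: filterS => t H; apply: norm_le_coord; first exact: ltW.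
by move=> j; rewrite !mxE.
Qed.

(** Convertible with the row built inside [leb_int], so slices of an iterated integral are
    recognised without rewriting. *)
Definition cons_row m (x : R) (v : 'rV[R]_m) : 'rV[R]_m.+1 :=
  row_mx (\row_(_ < 1) x) v.

Lemma cons_row0 m x (v : 'rV[R]_m) : cons_row x v 0 ord0 = x.
Proof.
rewrite /cons_row; have -> : @ord0 m = lshift m (@ord0 0) by apply/val_inj.
by apply: etrans (row_mxEl (\row__ x) v 0 0) _; rewrite mxE.
Qed.

Lemma cons_rowS m x (v : 'rV[R]_m) j : cons_row x v 0 (lift ord0 j) = v 0 j.
Proof.
rewrite /cons_row; have -> : lift ord0 j = rshift 1 j by apply/val_inj.
exact: (row_mxEr (\row__ x) v 0 j).
Qed.

Lemma cons_row_cvg (T : Type) (F : set_system T) {FF : Filter F} m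
    (g : T -> R) (h : T -> 'rV[R]_m) x v :
  g @ F --> x -> h @ F --> v -> cons_row (g t) (h t) @[t --> F] --> cons_row x v.
Proof.
move=> gx hv; apply: rV_cvg => j; case: (unliftP ord0 j) => [k ->|->].
  rewrite cons_rowS; under eq_fun do rewrite cons_rowS.
  apply: (@cvg_comp _ _ _ h (fun w : 'rV[R]_m => w 0 k) F (nbhs v)) hv _.
  exact: coord_continuous.
by rewrite cons_row0; under eq_fun do rewrite cons_row0.
Qed.

Lemma cons_row_add0 m x a (v : 'rV[R]_m) :
  cons_row (x + a) v = cons_row x v + a *: delta_mx 0 ord0.
Proof.
apply/rowP => i; rewrite [RHS]mxE [X in _ = _ + X]mxE [X in _ = _ + _ * X]mxE.
case: (unliftP ord0 i) => [i' ->|->]; first by rewrite !cons_rowS /= mulr0 addr0.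
by rewrite !cons_row0 /= mulr1.
Qed.

Lemma cons_row_addS m x a (v : 'rV[R]_m) j :
  cons_row x v + a *: delta_mx 0 (lift ord0 j) = cons_row x (v + a *: delta_mx 0 j).
Proof.
apply/rowP => i; rewrite [LHS]mxE [X in _ + X = _]mxE [X in _ + _ * X = _]mxE.
case: (unliftP ord0 i) => [i' ->|->].
  by rewrite !cons_rowS !mxE (inj_eq (@lift_inj _ _)).
by rewrite !cons_row0 /= mulr0 addr0.
Qed.

Lemma norm_cons_rowl m x (v : 'rV[R]_m) : `|x| <= `|cons_row x v|.
Proof. by rewrite -[in leLHS](cons_row0 x v) coord_le_norm. Qed.

Lemma norm_cons_rowr m x (v : 'rV[R]_m) : `|v| <= `|cons_row x v|.
Proof. by apply: norm_le_coord => // j; rewrite -(cons_rowS x v) coord_le_norm. Qed.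

Lemma closed_norm_ball_compact m (B : R) : compact [set v : 'rV[R]_m | `|v| <= B].
Proof.
apply: bounded_closed_compact.
  exists B; split; first exact: num_real.
  by move=> M BM v /= vB; apply: (le_trans vB); exact: ltW.
have -> : [set v : 'rV[R]_m | `|v| <= B] = Num.norm @^-1` [set x | x <= B] by [].
apply: preimage_closed; first by move=> v _; exact: norm_continuous.
exact: closed_le.
Qed.

End RowVectors.

(** * Nonnegative continuous functions vanishing outside a ball *)

Section CcPos.
Context {R : realType}.

(** The class on which the iterated integral is shown to be finite and linear. Asking for zeros
    outside a ball makes stability under slicing immediate, since a slice [v] has norm at most that
    of [cons_row x v]. *)
Definition Cc_pos m (f : 'rV[R]_m -> R) :=
  [/\ continuous f, forall v, 0 <= f v & exists B, forall v, B < `|v| -> f v = 0].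

Lemma Cc_posD m (f g : 'rV[R]_m -> R) :
  Cc_pos f -> Cc_pos g -> Cc_pos (fun v => f v + g v).
Proof.
move=> [cf f0 [B fB]] [cg g0 [C gC]]; split.
- by move=> v; exact: (cvgD (cf v) (cg v)).
- by move=> v; exact: addr_ge0.
- exists (Num.max B C) => v; rewrite gt_max => /andP[Bv Cv].
  by rewrite fB// gC// addr0.
Qed.

Lemma Cc_posZ m c (f : 'rV[R]_m -> R) :
  0 <= c -> Cc_pos f -> Cc_pos (fun v => c * f v).
Proof.
move=> c0 [cf f0 [B fB]]; split.
- by move=> v; exact: (cvgM (cvg_cst c) (cf v)).
- by move=> v; exact: mulr_ge0.
- by exists B => v Bv; rewrite fB// mulr0.
Qed.

Lemma Cc_pos_sum m (I : Type) (s : seq I) (f : I -> 'rV[R]_m -> R) :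
  (forall i, Cc_pos (f i)) -> Cc_pos (fun v => \sum_(i <- s) f i v).
Proof.
move=> fC; elim: s => [|i s IH].
  have -> : (fun v => \sum_(i <- [::]) f i v) = cst 0.
    by apply/funext => v; rewrite big_nil.
  by split; [exact: cst_continuous|by []|exists 0].
have -> : (fun v => \sum_(j <- i :: s) f j v) =
    (fun v => f i v + \sum_(j <- s) f j v).
  by apply/funext => v; rewrite big_cons.
exact: Cc_posD.
Qed.

(** A majorant in [Cc_pos] of the indicator of the ball of radius [B]; it carries uniform error
    terms through integrals. *)
Definition cutoff m (B : R) (v : 'rV[R]_m) : R := Num.max 0 (B + 1 - `|v|).

Lemma cutoff_ge1 m B (v : 'rV[R]_m) : `|v| <= B -> 1 <= cutoff B v.
Proof. by move=> vB; rewrite /cutoff le_max; apply/orP; right; lra. Qed.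

Lemma Cc_pos_cutoff m B : Cc_pos (@cutoff m B).
Proof.
split.
- move=> v; apply: (@continuous_max _ _ (cst 0) (fun v => B + 1 - `|v|)).
    exact: cst_continuous.
  exact: (cvgB (cvg_cst (B + 1)) (@norm_continuous _ _ v)).
- by move=> v; rewrite /cutoff le_max lexx.
- by exists (B + 1) => v Bv; rewrite /cutoff max_l//; lra.
Qed.

Lemma Cc_pos_cons_row m (f : 'rV[R]_m.+1 -> R) x :
  Cc_pos f -> Cc_pos (fun v => f (cons_row x v)).
Proof.
move=> [cf f0 [B fB]]; split => //.
- move=> v; apply: (@cvg_comp _ _ _ (cons_row x) f); last exact: cf.
  by apply: (@cons_row_cvg R _ (nbhs v) _ m (cst x) id x v); [exact: cvg_cst|exact: cvg_id].
- by exists B => v Bv; apply: fB; apply: (lt_le_trans Bv); exact: norm_cons_rowr.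
Qed.

(** Compactness of the ball of radius [B] makes continuity at [x] uniform in [v]; outside that ball
    both values vanish. *)
Lemma Cc_pos_unif m (f : 'rV[R]_m.+1 -> R) (x : R) : Cc_pos f ->
  exists B, forall e, 0 < e -> \forall y \near x, forall v,
    `|f (cons_row x v) - f (cons_row y v)| <= e * cutoff B v.
Proof.
move=> [cf f0 [B fB]]; exists B => e e0.
have /compact_near_coveringP/(_ R (nbhs x)
  (fun y v => `|f (cons_row x v) - f (cons_row y v)| <= e)) :=
  @closed_norm_ball_compact R m B.
have H : forall v : 'rV[R]_m, `|v| <= B ->
    \forall v' \near v & y \near x, `|f (cons_row x v') - f (cons_row y v')| <= e.
  move=> v _.
  have C1 : f (cons_row x p.1) @[p --> (v, x)] --> f (cons_row x v).
    apply: cvg_comp; last exact: cf.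
    by apply: (@cons_row_cvg R _ (nbhs (v, x)) _ m (cst x) fst x v);
      [exact: cvg_cst|exact: cvg_fst].
  have C2 : f (cons_row p.2 p.1) @[p --> (v, x)] --> f (cons_row x v).
    apply: cvg_comp; last exact: cf.
    by apply: (@cons_row_cvg R _ (nbhs (v, x)) _ m snd fst x v); [exact: cvg_snd|exact: cvg_fst].
  have := cvgB C1 C2; rewrite subrr => /(_ _)/cvgr0Pnorm_le; exact.
move=> /(_ _ H); apply: filterS => y Hy v.
have [vB|Bv] := leP `|v| B.
  apply: (le_trans (Hy v vB)); rewrite ler_peMr ?cutoff_ge1//; exact: ltW.
rewrite !fB ?(lt_le_trans Bv) ?norm_cons_rowr// subrr normr0 mulr_ge0//.
  exact: ltW.
by rewrite /cutoff le_max lexx.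
Qed.

End CcPos.

(** * Monotonicity, linearity and shear invariance of the iterated integral *)

Section LebInt.
Context {R : realType}.
Local Notation leb := (@lebesgue_measure R).

(* No measurability is required: the integral of a nonnegative function is a
   supremum over the simple functions below it. *)
Lemma ge0_le_integralT d (T : measurableType d) (mu : {measure set T -> \bar R})
    (f g : T -> \bar R) :
  (forall x, 0 <= f x)%E -> (forall x, f x <= g x)%E ->
  (\int[mu]_x f x <= \int[mu]_x g x)%E.
Proof.
move=> f0 fg; have g0 x : (0 <= g x)%E by exact: le_trans (f0 x) (fg x).
rewrite !ge0_integralTE//; apply: ereal_sup_le => _ [h /= hf <-].
by exists h => //= x; exact: le_trans (hf x) (fg x).
Qed.

Lemma leb_int_ge0 m (f : 'rV[R]_m -> \bar R) :
  (forall v, 0 <= f v)%E -> (0 <= leb_int f)%E.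
Proof.
by elim: m f => [|m IH] f f0 //=; apply: integral_ge0 => x _; exact: IH.
Qed.

Lemma le_leb_int m (f g : 'rV[R]_m -> \bar R) :
  (forall v, 0 <= f v)%E -> (forall v, f v <= g v)%E ->
  (leb_int f <= leb_int g)%E.
Proof.
elim: m f g => [|m IH] f g f0 fg //=.
by apply: ge0_le_integralT => x; [exact: leb_int_ge0|exact: IH].
Qed.

Lemma measurable_shift (k : R) :
  measurable_fun setT ((fun x => x + k) : measurableTypeR R -> measurableTypeR R).
Proof.
apply: continuous_measurable_fun => x.
exact: (cvgD (@cvg_id _ (nbhs x)) (cvg_cst k)).
Qed.

(** By uniqueness of Lebesgue measure it is enough to compare lengths of half-open intervals. *)
Lemma lebesgue_measure_shift (k : R) (A : set (measurableTypeR R)) :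
  measurable A ->
  pushforward leb ((fun x => x + k) : measurableTypeR R -> measurableTypeR R) A = leb A.
Proof.
move=> mA; apply/esym; move: A mA.
apply: lebesgue_measure_unique; first exact: measurable_shift.
move=> mk _ [[a b]] _ <- /=; rewrite /pushforward.
have -> : (fun x => x + k) @^-1` `]a, b]%classic = `](a - k), (b - k)]%classic.
  by apply/seteqP; split => x /=; rewrite !in_itv/= ltrBlDr lerBrDr.
rewrite !lebesgue_measure_itv /= !lte_fin ltrD2r; case: ifP => // _.
by rewrite -!EFinB; congr (_%:E); ring.
Qed.

Lemma integral_shift (k : R) (f : R -> \bar R) :
  measurable_fun setT (f : measurableTypeR R -> \bar R) -> (forall x, 0 <= f x)%E ->
  (\int[leb]_x f (x + k)%R = \int[leb]_x f x)%E.
Proof.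
move=> mf f0.
have := @ge0_integral_pushforward _ _ _ _ _ _ (measurable_shift k) leb setT f
  measurableT mf (fun y _ => f0 y).
rewrite preimage_setT /comp => <-.
apply: eq_measure_integral => [|mk A mA _]; first exact: measurable_shift.
exact: lebesgue_measure_shift.
Qed.

(** The three properties are bundled as one induction hypothesis: in dimension [m] they yield
    continuity, hence measurability, of the slice integrals, which is what linearity of the outer
    integral in dimension [m.+1] requires. *)
Definition leb_int_linear m :=
  [/\ forall f : 'rV[R]_m -> R, Cc_pos f -> (leb_int (fun v => (f v)%:E) < +oo)%E,
      forall f g : 'rV[R]_m -> R, Cc_pos f -> Cc_pos g ->
        leb_int (fun v => (f v + g v)%:E) =
        (leb_int (fun v => (f v)%:E) + leb_int (fun v => (g v)%:E))%E &
      forall c (f : 'rV[R]_m -> R), 0 <= c -> Cc_pos f ->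
        leb_int (fun v => (c * f v)%:E) = (c%:E * leb_int (fun v => (f v)%:E))%E].

Definition slice_int m (f : 'rV[R]_m.+1 -> R) (x : R) : R :=
  fine (leb_int (fun v => (f (cons_row x v))%:E)).

Section Slice.
Variables (m : nat) (lin : leb_int_linear m).
Implicit Type f : 'rV[R]_m.+1 -> R.

Lemma slice_intE f x : Cc_pos f ->
  leb_int (fun v => (f (cons_row x v))%:E) = (slice_int f x)%:E.
Proof.
move=> fC; rewrite /slice_int fineK// ge0_fin_numE.
  by have [fin _ _] := lin; apply/fin/Cc_pos_cons_row.
by apply: leb_int_ge0 => v; rewrite lee_fin; have [_ f0 _] := fC.
Qed.

Lemma slice_int_ge0 f x : Cc_pos f -> 0 <= slice_int f x.
Proof.
move=> [_ f0 _]; apply: fine_ge0; apply: leb_int_ge0 => v.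
by rewrite lee_fin.
Qed.

(** Two nearby slices differ by at most [e * cutoff B], so their integrals differ by at most [e]
    times the finite integral [b] of the cutoff. *)
Lemma slice_int_continuous f : Cc_pos f -> continuous (slice_int f).
Proof.
move=> fC x; have [B HB] := Cc_pos_unif x fC.
have [fin add scale] := lin.
have bC : Cc_pos (@cutoff R m B) := @Cc_pos_cutoff R m B.
have b0 : (0 <= leb_int (fun v => (@cutoff R m B v)%:E))%E.
  by apply: leb_int_ge0 => v; rewrite lee_fin; case: bC.
have [b bE] : exists b, leb_int (fun v => (@cutoff R m B v)%:E) = b%:E.
  by exists (fine (leb_int (fun v => (@cutoff R m B v)%:E))); rewrite fineK// ge0_fin_numE// fin.
rewrite bE lee_fin in b0.
have key e y z : 0 <= e ->
    (forall v, f (cons_row y v) <= f (cons_row z v) + e * cutoff B v) ->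
    slice_int f y <= slice_int f z + e * b.
  move=> e0 H; rewrite -lee_fin EFinD EFinM -!slice_intE// -bE -scale// -add//.
  - apply: le_leb_int => v; rewrite lee_fin; last exact: H.
    by have [_ + _] := fC.
  - exact: Cc_pos_cons_row.
  - exact: Cc_posZ.
apply/cvgrPdist_le => e e0.
(* Dividing by [b + 1] instead of [b] covers the case [b = 0]. *)
have e1 : 0 < e / (b + 1) by apply: divr_gt0 => //; lra.
have eb : e / (b + 1) * b <= e.
  rewrite mulrAC ler_pdivrMr; last lra.
  by apply: ler_wpM2l; lra.
have := HB _ e1; apply: filterS => y Hy.
rewrite ler_distl; apply/andP; split.
  rewrite lerBlDr; apply: (@le_trans _ _ (slice_int f x + e / (b + 1) * b)); last by rewrite lerD2l.
  apply: key => [|v]; first exact: ltW.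
  by have := Hy v; rewrite ler_norml => /andP[]; lra.
apply: (@le_trans _ _ (slice_int f y + e / (b + 1) * b)); last by rewrite lerD2l.
apply: key => [|v]; first exact: ltW.
by have := Hy v; rewrite ler_norml => /andP[]; lra.
Qed.

Lemma slice_int_measurable f : Cc_pos f ->
  measurable_fun setT ((EFin \o slice_int f) : measurableTypeR R -> \bar R).
Proof.
move=> fC; apply/measurable_EFinP; apply: continuous_measurable_fun.
exact: slice_int_continuous.
Qed.

Lemma leb_int_slice f : Cc_pos f ->
  leb_int (fun v => (f v)%:E) = (\int[leb]_x (slice_int f x)%:E)%E.
Proof. by move=> fC /=; apply: eq_integral => x _; exact: slice_intE. Qed.

Lemma slice_int_lty f : Cc_pos f -> (\int[leb]_x (slice_int f x)%:E < +oo)%E.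
Proof.
move=> fC; have [_ _ [B fB]] := fC.
have zero x : B < `|x| -> slice_int f x = 0.
  move=> Bx; apply: EFin_inj; rewrite -slice_intE//.
  have [_ _ scale] := lin.
  (* The zero slice is written as [0] times itself so that homogeneity gives its integral. *)
  have -> : (fun v => (f (cons_row x v))%:E) = (fun v => (0 * f (cons_row x v))%:E).
    by apply/funext => v; rewrite fB ?mul0r// (lt_le_trans Bx)// norm_cons_rowl.
  by rewrite scale ?mul0e//; exact: Cc_pos_cons_row.
have cJ : {within `[- B, B], continuous (slice_int f)}.
  by apply: continuous_subspaceT; exact: slice_int_continuous.
have /integrableP[_] := continuous_compact_integrable (@segment_compact _ (-B) B) cJ.
rewrite integral_mkcond; congr (_ < _)%E; apply: eq_integral => x _.
rewrite patchE; case: ifPn => [_|].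
  by rewrite /= ger0_norm// slice_int_ge0.
rewrite notin_setE /= in_itv/= -ler_norml => /negP; rewrite -ltNge => /zero ->.
by [].
Qed.

Lemma leb_int_linearS : leb_int_linear m.+1.
Proof.
have [_ add scale] := lin.
have J0 f x : Cc_pos f -> (0 <= (slice_int f x)%:E)%E.
  by move=> fC; rewrite lee_fin slice_int_ge0.
split.
- by move=> f fC; rewrite leb_int_slice// slice_int_lty.
- move=> f g fC gC; rewrite (@leb_int_slice (fun v => f v + g v)); last exact: Cc_posD.
  rewrite !leb_int_slice// -ge0_integralD//; last 4 first.
  + by move=> x _; exact: J0.
  + exact: slice_int_measurable.
  + by move=> x _; exact: J0.
  + exact: slice_int_measurable.
  apply: eq_integral => x _; rewrite -!slice_intE//; last exact: Cc_posD.
  by apply: add; exact: Cc_pos_cons_row.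
- move=> c f c0 fC; rewrite (@leb_int_slice (fun v => c * f v)); last exact: Cc_posZ.
  rewrite !leb_int_slice// -ge0_integralZl//; last 2 first.
  + exact: slice_int_measurable.
  + by move=> x _; exact: J0.
  apply: eq_integral => x _; rewrite -!slice_intE//; last exact: Cc_posZ.
  by apply: scale => //; exact: Cc_pos_cons_row.
Qed.

End Slice.

Lemma leb_int_linearP m : leb_int_linear m.
Proof.
elim: m => [|m IH]; last exact: leb_int_linearS.
by split => //= f _; rewrite ltry.
Qed.

(* The displacement may depend on the coordinates integrated further out. *)
Lemma leb_int_shear m (j : 'I_m) (k : 'rV[R]_m -> R) (f : 'rV[R]_m -> R) :
  (forall v w : 'rV[R]_m, (forall i : 'I_m, (i < j)%N -> v 0 i = w 0 i) -> k v = k w) ->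
  Cc_pos f ->
  leb_int (fun v => (f (v + k v *: delta_mx 0 j))%:E) = leb_int (fun v => (f v)%:E).
Proof.
elim: m j k f => [|m IH] j k f kj fC; first by case: j kj.
case: (unliftP ord0 j) kj => [j' ->|->] kj.
  (* Once the first coordinate is fixed, the displacement depends only on the coordinates of the
     slice that precede [j']. *)
  apply: eq_integral => x _.
  rewrite -[RHS](IH j' (fun v => k (cons_row x v))).
  - congr leb_int; apply/funext => v; congr ((f _)%:E).
    exact: cons_row_addS.
  - move=> v w vw; apply: kj => i; case: (unliftP ord0 i) => [i' ->|-> _].
      by rewrite !cons_rowS => H; apply: vw.
    by rewrite !cons_row0.
  - exact: Cc_pos_cons_row.
(* No coordinate precedes the outermost one, so the displacement is constant and one-dimensional
   translation invariance applies. *)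
have k0 v : k v = k 0 by apply: kj.
have lin := leb_int_linearP m.
rewrite (leb_int_slice lin fC) -(@integral_shift (k 0) (EFin \o slice_int f)); last 2 first.
- exact: slice_int_measurable.
- by move=> x; rewrite lee_fin slice_int_ge0.
apply: eq_integral => x _ /=; rewrite -slice_intE//.
congr leb_int; apply/funext => v; rewrite k0; congr ((f _)%:E).
exact/esym/cons_row_add0.
Qed.

End LebInt.

(** * Distance to the boundary of a convex set *)

Section EuclideanDistance.
Context {R : realType} {m : nat}.
Implicit Types (a b c : 'rV[R]_m) (A : set 'rV[R]_m).

Lemma eucl_dotC a b : eucl_dot a b = eucl_dot b a.
Proof. by apply: eq_bigr => j _; rewrite mulrC. Qed.

Lemma eucl_dotDl a b c : eucl_dot (a + b) c = eucl_dot a c + eucl_dot b c.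
Proof. by rewrite -big_split; apply: eq_bigr => j _; rewrite mxE mulrDl. Qed.

Lemma eucl_dotZl k a b : eucl_dot (k *: a) b = k * eucl_dot a b.
Proof. by rewrite mulr_sumr; apply: eq_bigr => j _; rewrite mxE mulrA. Qed.

Lemma eucl_dotBl a b c : eucl_dot (a - b) c = eucl_dot a c - eucl_dot b c.
Proof. by rewrite eucl_dotDl -scaleN1r eucl_dotZl mulN1r. Qed.

Lemma eucl_dotZr k a b : eucl_dot a (k *: b) = k * eucl_dot a b.
Proof. by rewrite eucl_dotC eucl_dotZl eucl_dotC. Qed.

Lemma eucl_dotBr a b c : eucl_dot c (a - b) = eucl_dot c a - eucl_dot c b.
Proof. by rewrite eucl_dotC eucl_dotBl !(eucl_dotC c). Qed.

Lemma eucl_dot_subZ t a b : eucl_dot (a - t *: b) (a - t *: b) =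
  eucl_dot a a - 2 * t * eucl_dot b a + t ^+ 2 * eucl_dot b b.
Proof.
by rewrite eucl_dotBl !eucl_dotBr !eucl_dotZl !eucl_dotZr (eucl_dotC a b); ring.
Qed.

Lemma eucl_dot_ge0 a : 0 <= eucl_dot a a.
Proof. by apply: sumr_ge0 => j _; rewrite -expr2 sqr_ge0. Qed.

Lemma eucl_dot_eq0 a : eucl_dot a a = 0 -> a = 0.
Proof.
move=> /eqP; rewrite psumr_eq0; last by move=> j _; rewrite -expr2 sqr_ge0.
move=> /allP H; apply/rowP => j; rewrite mxE; apply/eqP.
by have := H j (mem_index_enum j); rewrite -expr2 sqrf_eq0.
Qed.

Lemma coord_sqr_le_dot a j : a 0 j ^+ 2 <= eucl_dot a a.
Proof.
rewrite /eucl_dot (bigD1 j)//= -expr2 lerDl.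
by apply: sumr_ge0 => i _; rewrite -expr2 sqr_ge0.
Qed.

Lemma eucl_distC a b : eucl_dist a b = eucl_dist b a.
Proof.
by rewrite /eucl_dist -opprB -scaleN1r eucl_dotZl eucl_dotZr !mulN1r opprK.
Qed.

Lemma eucl_dist_ge0 a b : 0 <= eucl_dist a b.
Proof. exact: sqrtr_ge0. Qed.

Lemma eucl_dist_addZ a b k :
  0 <= k -> eucl_dist a (a + k *: b) = k * Num.sqrt (eucl_dot b b).
Proof.
move=> k0; rewrite eucl_distC /eucl_dist addrAC subrr add0r eucl_dotZl eucl_dotZr mulrA.
by rewrite sqrtrM -?expr2 ?sqr_ge0// sqrtr_sqr ger0_norm.
Qed.

Lemma dist_set_le a b A : A b -> dist_set a A <= eucl_dist a b.
Proof.
move=> Ab; apply: ge_inf; last by exists b.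
by exists 0 => _ [c _ <-]; exact: eucl_dist_ge0.
Qed.

(** Otherwise the parameters in [[0, 1]] whose point lies in [A] would form a nonempty, open and
    closed subset, hence all of [[0, 1]], including the endpoint [b]. Closedness holds because a
    point of [closure A] off the boundary is in [A]. *)
Lemma segment_boundary A a b : open A -> A a -> ~ A b ->
  exists2 s, 0 <= s <= 1 & boundary A (a + s *: (b - a)).
Proof.
move=> oA Aa Ab; apply: contrapT => H.
pose g (s : R) : 'rV[R]_m := a + s *: (b - a).
have cg : continuous g.
  move=> s; apply: rV_cvg => j; rewrite /g.
  under eq_fun do rewrite !mxE; rewrite !mxE.
  apply: cvgD; first exact: cvg_cst.
  by apply: cvgM; [exact: cvg_id|exact: cvg_cst].
have /(_ (`[0, 1] `&` g @^-1` A)) E := @segment_connected R 0 1.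
have : (`[0, 1] `&` g @^-1` A)%classic = `[0, 1]%classic.
  apply: E.
  - by exists 0; split; rewrite /g /= ?in_itv/= ?lexx ?ler01// scale0r addr0.
  - exists (g @^-1` A) => //.
    by apply: open_comp => // s _; exact: cg.
  - exists (g @^-1` closure A).
      by apply: preimage_closed => [s _|]; [exact: cg|exact: closed_closure].
    apply/seteqP; split => s [s01 gs]; split => //=.
      exact: subset_closure.
    apply: contrapT => Ngs; apply: H; exists s; first by move: s01; rewrite /= in_itv.
    by split => //; have /interior_id -> := oA.
move=> /seteqP[_ /(_ 1)]; rewrite /= in_itv/= lexx ler01 => /(_ erefl)[_].
by rewrite /g scale1r addrC subrK.
Qed.

End EuclideanDistance.

(** * The supporting hyperplane at a nearest boundary point *)

Section SupportingHyperplane.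
Context {R : realType} {m : nat} (Omega : set 'rV[R]_m).
Hypotheses (hopen : open Omega) (hconv : econvex Omega).
Context (xi c : 'rV[R]_m).
Hypotheses (Oxi : Omega xi) (bc : boundary Omega c)
  (dc : eucl_dist xi c = dist_set xi (boundary Omega)).
Local Notation d x := (dist_set x (boundary Omega)).
Local Notation nu := ((eucl_dist c xi)^-1 *: (c - xi)).

Let notOc : ~ Omega c.
Proof. by case: bc => _ /=; have /interior_id -> := hopen. Qed.

Lemma dist_boundary_gt0 : 0 < d xi.
Proof.
rewrite -dc lt_neqAle eucl_dist_ge0 andbT eq_sym; apply/eqP => H.
apply: notOc; suff -> : c = xi by [].
have /eqP := H; rewrite sqrtr_eq0 => H0.
apply/esym/eqP; rewrite -subr_eq0; apply/eqP/eucl_dot_eq0.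
by apply/eqP; rewrite eq_le H0 eucl_dot_ge0.
Qed.

Let w := c - xi.

Let dot_w : eucl_dot w w = d xi ^+ 2.
Proof.
by rewrite -dc eucl_distC /eucl_dist sqr_sqrtr// eucl_dot_ge0.
Qed.

(* If [z] were on the wrong side, [c] would lie between [z] and a point of the
   open ball of radius [d xi] around [xi]. *)
Let separation z : Omega z -> eucl_dot (z - c) w < 0.
Proof.
move=> Oz; rewrite ltNge; apply/negP => H.
have d0 := dist_boundary_gt0.
(* A small push along [w] stays in the open set and makes the wrong-side inequality strict. *)
have [s s0 Ozs] : exists2 s : R, 0 < s & Omega (z + s *: w).
  have C : z + s *: w @[s --> (0 : R)] --> z.
    apply: rV_cvg => j; under eq_fun do rewrite !mxE.
    have := cvgD (@cvg_cst R (z 0 j) R (nbhs 0) _)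
      (cvgM (@cvg_id R (nbhs 0)) (@cvg_cst R (w 0 j) R (nbhs 0) _)).
    rewrite mul0r addr0 /w !mxE; exact.
  have : \forall s \near 0, Omega (z + s *: w) by apply: C; exact: open_nbhs_nbhs.
  move=> /nbhs_ballP[e /= e0 He]; exists (e / 2); first exact: divr_gt0.
  by apply: He; rewrite /ball/= sub0r normrN gtr0_norm ?divr_gt0//; lra.
pose q := z + s *: w - c; pose qq := eucl_dot q q.
have beta0 : 0 < eucl_dot q w.
  rewrite /q addrAC eucl_dotDl eucl_dotZl dot_w.
  by apply: ltr_wpDl => //; apply: mulr_gt0 => //; exact: exprn_gt0.
set beta := eucl_dot q w in beta0.
have qq0 : 0 <= qq := eucl_dot_ge0 q.
(* With [t * (qq + 1) = beta], the squared norm of [w - t *: q] is [d xi ^+ 2 - t * beta - t ^+ 2],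
   so [b] falls strictly inside the ball around [xi]. *)
pose t := beta / (qq + 1).
have qq1 : 0 < qq + 1 by lra.
have t0 : 0 < t by exact: divr_gt0.
pose b := c - t *: q.
have ball_b : eucl_dot (b - xi) (b - xi) < d xi ^+ 2.
  rewrite (_ : b - xi = w - t *: q); last by rewrite /b /w addrAC.
  rewrite eucl_dot_subZ dot_w -/beta -/qq.
  have tq : t * (qq + 1) = beta by rewrite /t divfK// gt_eqF.
  have : 0 < t * (t * qq + 2 * t) by nra.
  have -> : t * (t * qq + 2 * t) = t * beta + t ^+ 2 by rewrite -tq; ring.
  nra.
have Ob : Omega b.
  (* If [b] were outside, the segment from [xi] to [b] would meet the boundary at distance less than
     [d xi]. *)
  apply: contrapT => /(segment_boundary hopen Oxi)[k /andP[k0 k1]].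
  move=> /(dist_set_le xi); rewrite eucl_dist_addZ// leNgt => /negP; apply.
  have lt1 : Num.sqrt (eucl_dot (b - xi) (b - xi)) < d xi.
    by rewrite -[ltRHS](gtr0_norm d0) -sqrtr_sqr ltr_sqrt// exprn_gt0.
  apply: le_lt_trans lt1; rewrite ler_piMl// sqrtr_ge0.
apply: notOc; have t1 : 1 + t != 0 by rewrite gt_eqF//; lra.
(* By the choice of [b], the point [c] is the convex combination of [b] and [z + s *: w] with
   weights proportional to [1] and [t]. *)
have -> : c = (1 + t)^-1 *: b + (1 - (1 + t)^-1) *: (z + s *: w).
  apply/rowP => j; rewrite /b /q !mxE; field.
  by rewrite t1.
apply: hconv => //; rewrite invr_ge0 invf_le1; lra.
Qed.

Let dot_nu_w : eucl_dot nu w = d xi.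
Proof.
rewrite eucl_dotZl dot_w eucl_distC dc expr2 mulKf// gt_eqF//.
exact: dist_boundary_gt0.
Qed.

Let dot_nu : eucl_dot nu nu = 1.
Proof.
rewrite eucl_dotZr dot_nu_w eucl_distC dc mulVf// gt_eqF//.
exact: dist_boundary_gt0.
Qed.

(** From [eta] travel along the unit vector [nu] up to the hyperplane through [c]. The length
    travelled is [l], which equals the right-hand side, and the endpoint is not in [Omega] by
    [separation]; so the boundary is met within distance [l]. *)
Lemma dist_boundary_support eta :
  Omega eta -> d eta <= d xi - eucl_dot (eta - xi) nu.
Proof.
move=> Oeta; have d0 := dist_boundary_gt0.
pose l := - ((d xi)^-1 * eucl_dot (eta - c) w).
have l0 : 0 < l.
  rewrite /l oppr_gt0 pmulr_rlt0 ?invr_gt0//; exact: separation.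
have Nz : ~ Omega (eta + l *: nu).
  move=> /separation; rewrite addrAC eucl_dotDl eucl_dotZl dot_nu_w /l mulNr.
  by rewrite mulrAC mulVf ?gt_eqF// mul1r subrr ltxx.
have [k /andP[k0 k1]] := segment_boundary hopen Oeta Nz.
rewrite addrAC subrr add0r scalerA => /(dist_set_le eta) H.
apply: (le_trans H); rewrite eucl_dist_addZ ?mulr_ge0 ?(ltW l0)//.
rewrite dot_nu sqrtr1 mulr1; apply: (@le_trans _ _ l).
  by rewrite ler_piMl// ltW.
rewrite /l eucl_dotZr eucl_distC dc -/w.
have -> : eta - c = eta - xi - w by rewrite /w opprB addrA subrK.
rewrite (eucl_dotBl _ w) dot_w mulrBr opprB expr2 mulKf ?gt_eqF//.
Qed.

Lemma normal_coord_le1 j : `|nu 0 j| <= 1.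
Proof.
by rewrite -(@ler_pXn2r _ 2)// ?nnegrE// real_normK ?num_real// expr1n -dot_nu coord_sqr_le_dot.
Qed.

End SupportingHyperplane.

(** The supporting inequality, used with the roles of the two points exchanged, makes the distance
    Lipschitz on [Omega]. The constant [m] appears because the matrix norm is the sup norm and each
    coordinate of the normal is at most 1 in absolute value. *)
Lemma dist_boundary_continuous (R : realType) m (Omega : set 'rV[R]_m)
    (xihat : 'rV[R]_m -> 'rV[R]_m) :
  open Omega -> econvex Omega ->
  (forall xi, Omega xi -> boundary Omega (xihat xi) /\
     eucl_dist xi (xihat xi) = dist_set xi (boundary Omega)) ->
  forall xi, Omega xi -> {for xi, continuous (fun x => dist_set x (boundary Omega))}.
Proof.
move=> hopen hconv hat xi Oxi.
have key x y : Omega x -> Omega y ->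
    dist_set y (boundary Omega) <= dist_set x (boundary Omega) + m%:R * `|x - y|.
  move=> Ox Oy; have [bx dx] := hat _ Ox.
  apply: (le_trans (dist_boundary_support hopen hconv Ox bx dx Oy)); rewrite lerD2l.
  rewrite -sumrN -[m in m%:R](card_ord m) mulr_natl -sumr_const.
  apply: ler_sum => j _; apply: (le_trans (ler_norm _)); rewrite normrN normrM.
  rewrite -[leRHS]mulr1 ler_pM//.
    by have := coord_le_norm (y - x) j; rewrite distrC.
  exact: (normal_coord_le1 hopen Ox bx dx).
rewrite /prop_for /continuous_at.
apply/(@cvgrPdist_le R R^o _ (nbhs xi)) => e e0.
have Onear : \forall y \near xi, Omega y by exact: open_nbhs_nbhs.
have e1 : 0 < e / (m%:R + 1) by rewrite divr_gt0// ltr_wpDl.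
have Bnear : \forall y \near xi, `|xi - y| <= e / (m%:R + 1).
  by have /cvgrPdist_le/(_ _ e1) := @cvg_id _ (nbhs xi); apply.
near=> y.
have Oy : Omega y by near: y.
have : m%:R * `|xi - y| <= e.
  have : `|xi - y| <= e / (m%:R + 1) by near: y.
  rewrite ler_pdivlMr ?ltr_wpDl// => H; apply: le_trans H.
  by rewrite mulrC ler_wpM2l// lerDl.
have := key _ _ Oxi Oy; have := key _ _ Oy Oxi; rewrite (distrC y).
by rewrite ler_norml; lra.
Unshelve. all: by end_near. Qed.

(** * The Hardy inequality for one field *)

Section DirectionalDerivative.
Context {R : realType} {m : nat}.
Implicit Types (u : 'rV[R]_m -> R) (x v w : 'rV[R]_m).

Lemma is_derive_line u x v (s : R) : derivable u (x + s *: v) v ->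
  is_derive s (1 : R) (fun s => u (x + s *: v)) ('D_v u (x + s *: v)).
Proof.
have E : (fun h : R => h^-1 *: (((fun s => u (x + s *: v)) \o shift s) (h *: 1) - u (x + s *: v)))
   = (fun h : R => h^-1 *: ((u \o shift (x + s *: v)) (h *: v) - u (x + s *: v))).
  apply/funext => h /=; congr (_ *: (u _ - _)).
  by rewrite [h *: 1]mulr1 scalerDl addrCA.
move=> du; apply: DeriveDef; first by rewrite /derivable E.
by rewrite /derive E.
Qed.

(** Both signs of [h] are covered because [deriveDZ] uses the increment [h * k]. *)
Lemma line_MVT u x v (h : R) : (forall y, derivable u y v) ->
  exists2 t : R, `|t| <= `|h| & u (x + h *: v) - u x = h * 'D_v u (x + t *: v).
Proof.
move=> du; pose f (s : R) := u (x + s *: v).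
have df (s : R) : is_derive s 1 f ('D_v u (x + s *: v)) by exact: is_derive_line.
have cf (a b : R) : {within `[a, b], continuous f}.
  by apply: derivable_within_continuous => s _; exact: (@ex_derive _ _ _ _ _ _ _ (df s)).
have f0 : f 0 = u x by rewrite /f scale0r addr0.
have [h0|h0] := leP 0 h.
  have [t] := MVT_segment h0 (fun s _ => df s) (cf 0 h).
  rewrite in_itv/= => /andP[t0 th] E; exists t; first by rewrite !ger0_norm.
  by rewrite -/(f h) -f0 E subr0 mulrC.
have [t] := MVT_segment (ltW h0) (fun s _ => df s) (cf h 0).
rewrite in_itv/= => /andP[th t0] E; exists t.
  by rewrite (ler0_norm t0) (ltr0_norm h0) lerN2.
by rewrite -/(f h) -f0 -opprB E sub0r mulrN opprK mulrC.
Qed.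

(** The increment is split into a move along [v] from [x], then a move along [w]. The mean value
    theorem turns the second into [h * k] times ['D_w u] at a point tending to [x], where that
    derivative is continuous. *)
Lemma deriveDZ u x v w (k : R) :
  (forall y z, derivable u y z) -> {for x, continuous ('D_w u)} ->
  'D_(v + k *: w) u x = 'D_v u x + k * 'D_w u x.
Proof.
move=> du cw.
have /choice[t tP] (h : R) : exists t : R, `|t| <= `|h * k| /\
    u (x + h *: v + (h * k) *: w) - u (x + h *: v) =
    h * k * 'D_w u (x + h *: v + t *: w).
  by have [t ? ?] := line_MVT (x + h *: v) (h * k) (fun y => du y w); exists t.
have id0 : h @[h --> 0^'] --> (0 : R) by exact: cvg_within.
have t0 : t h @[h --> 0^'] --> (0 : R).
  have n0 : `|h * k| @[h --> 0^'] --> (0 : R).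
    have := cvg_norm (cvgM id0 (@cvg_cst R k R 0^' _)).
    by rewrite mul0r normr0; exact.
  apply: (@squeeze_cvgr _ _ _ _ (fun h : R => - `|h * k|) (fun h : R => `|h * k|)) => //.
    by near=> h; rewrite -ler_norml; case: (tP h).
  by have := cvgN n0; rewrite oppr0; exact.
have C1 : 'D_w u (x + h *: v + t h *: w) @[h --> 0^'] --> 'D_w u x.
  apply: (@cvg_comp _ _ _ (fun h => x + h *: v + t h *: w) ('D_w u) _ (nbhs x)) => //.
  have := cvgD (cvgD (@cvg_cst _ x R 0^' _) (cvgZ id0 (@cvg_cst _ v R 0^' _)))
    (cvgZ t0 (@cvg_cst _ w R 0^' _)).
  rewrite !scale0r !addr0; exact.
have C2 : h^-1 *: ((u \o shift x) (h *: v) - u x) @[h --> 0^'] --> 'D_v u x.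
  exact: du.
apply: cvg_lim => //.
have C3 : h^-1 *: ((u \o shift x) (h *: v) - u x) +
    k * 'D_w u (x + h *: v + t h *: w) @[h --> 0^'] --> 'D_v u x + k * 'D_w u x.
  exact: (cvgD C2 (cvgM (@cvg_cst R k R 0^' _) C1)).
apply: cvg_trans C3; apply: near_eq_cvg; near=> h.
have h0 : h != 0 by near: h; exact: nbhs_dnbhs_neq.
have [_ E] := tP h.
rewrite /=.
have -> : h *: (v + k *: w) + x = x + h *: v + (h * k) *: w.
  by rewrite scalerDr scalerA addrC addrA.
apply: (mulfI h0); rewrite mulrDr ![_ *: _]/(_ * _) !mulrA mulfV// !mul1r.
by rewrite -E (addrC (h *: v)); ring.
Unshelve. all: by end_near. Qed.

End DirectionalDerivative.

(** * The iterated integral as a real-valued functional on [Cc_pos] *)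

Section CcPosIntegral.
Context {R : realType} {m : nat}.
Implicit Types f g : 'rV[R]_m -> R.

Definition cc_int f : R := fine (leb_int (fun v => (f v)%:E)).

Lemma cc_intE f : Cc_pos f -> leb_int (fun v => (f v)%:E) = (cc_int f)%:E.
Proof.
move=> fC; rewrite /cc_int fineK// ge0_fin_numE.
  by have [fin _ _] := @leb_int_linearP R m; exact: fin.
by apply: leb_int_ge0 => v; rewrite lee_fin; have [_ f0 _] := fC.
Qed.

Lemma cc_intD f g : Cc_pos f -> Cc_pos g ->
  cc_int (fun v => f v + g v) = cc_int f + cc_int g.
Proof.
move=> fC gC; have [_ add _] := @leb_int_linearP R m.
by apply: EFin_inj; rewrite EFinD -!cc_intE// ?add//; exact: Cc_posD.
Qed.

Lemma cc_intZ c f : 0 <= c -> Cc_pos f -> cc_int (fun v => c * f v) = c * cc_int f.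
Proof.
move=> c0 fC; have [_ _ scale] := @leb_int_linearP R m.
by apply: EFin_inj; rewrite EFinM -!cc_intE// ?scale//; exact: Cc_posZ.
Qed.

Lemma le_cc_int f g : Cc_pos f -> Cc_pos g -> (forall v, f v <= g v) ->
  cc_int f <= cc_int g.
Proof.
move=> fC gC fg; rewrite -lee_fin -!cc_intE//; apply: le_leb_int => v; rewrite lee_fin//.
by have [] := fC.
Qed.

Lemma cc_int_ge0 f : Cc_pos f -> 0 <= cc_int f.
Proof.
by move=> [_ f0 _]; apply: fine_ge0; apply: leb_int_ge0 => v; rewrite lee_fin.
Qed.

Lemma cc_int_sum (I : Type) (s : seq I) (F : I -> 'rV[R]_m -> R) :
  (forall i, Cc_pos (F i)) ->
  cc_int (fun v => \sum_(i <- s) F i v) = \sum_(i <- s) cc_int (F i).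
Proof.
move=> FC; elim: s => [|i s IH].
  (* The integral of the zero function is obtained by scaling a cutoff by [0]. *)
  rewrite big_nil; have := cc_intZ (lexx (0 : R)) (@Cc_pos_cutoff R m 0).
  rewrite mul0r => E; apply: etrans E.
  by congr cc_int; apply/funext => v; rewrite big_nil mul0r.
rewrite big_cons -IH -cc_intD//; last exact: Cc_pos_sum.
by congr cc_int; apply/funext => v; rewrite big_cons.
Qed.

(** If [phi v] lies in the ball supporting [f], then [v] lies in the [psi]-image of that ball, which
    is compact and so bounded. *)
Lemma Cc_pos_comp f (phi psi : 'rV[R]_m -> 'rV[R]_m) :
  continuous phi -> continuous psi -> cancel phi psi ->
  Cc_pos f -> Cc_pos (fun v => f (phi v)).
Proof.
move=> cphi cpsi phiK [cf f0 [B fB]]; split => //.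
  by move=> v; apply: (@cvg_comp _ _ _ phi f); [exact: cphi|exact: cf].
have /compact_bounded[M [_ HM]] : compact (psi @` [set v | `|v| <= B]).
  apply: continuous_compact; last exact: closed_norm_ball_compact.
  exact: continuous_subspaceT.
exists (M + 1) => v Mv; apply: fB; rewrite ltNge; apply/negP => vB.
have : `|v| <= M + 1 by apply: (HM (M + 1)); [rewrite ltrDl|exists (phi v)].
by rewrite leNgt Mv.
Qed.

End CcPosIntegral.

(** First [(a * b)^2 <= 1 - q^2 <= (1 - q^2/2)^2]; then [(a + b)^2 <= 2 + 2ab <= 4 - q^2 <= (2 -
    q^2/4)^2]. *)
Lemma sqrt_ratio_ineq (R : realType) (q a b : R) :
  0 <= a -> 0 <= b -> a ^+ 2 <= 1 - q -> b ^+ 2 <= 1 + q -> q ^+ 2 / 4 <= 2 - a - b.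
Proof.
move=> a0 b0 aq bq.
have q1 : 0 <= 1 - q by apply: le_trans aq; exact: sqr_ge0.
have q2 : 0 <= 1 + q by apply: le_trans bq; exact: sqr_ge0.
have q3 : q ^+ 2 <= 1 by nra.
have ab : a * b <= 1 - q ^+ 2 / 2.
  rewrite -(@ler_pXn2r _ 2)// ?nnegrE ?mulr_ge0//; last lra.
  apply: (@le_trans _ _ ((1 - q) * (1 + q))).
    by rewrite exprMn ler_pM// sqr_ge0.
  have : 0 <= (q ^+ 2) ^+ 2 by exact: sqr_ge0.
  nra.
have : a + b <= 2 - q ^+ 2 / 4.
  rewrite -(@ler_pXn2r _ 2)// ?nnegrE; [|lra|lra].
  have : 0 <= (q ^+ 2) ^+ 2 by exact: sqr_ge0.
  nra.
lra.
Qed.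

(** * The discrete ground-state argument for a field constant along its flow *)

Section HardyField.
Context {R : realType} {m : nat} (Omega : set 'rV[R]_m).
Hypotheses (hopen : open Omega) (hconv : econvex Omega).
Context (xihat : 'rV[R]_m -> 'rV[R]_m).
Hypothesis hxihat : forall xi, Omega xi -> boundary Omega (xihat xi) /\
     eucl_dist xi (xihat xi) = dist_set xi (boundary Omega).
Context (u : 'rV[R]_m -> R) (hu : Cc_infty Omega u).
Context (V : 'rV[R]_m -> 'rV[R]_m).
Hypotheses (cV : continuous V) (flowV : forall xi s, V (xi + s *: V xi) = V xi).
Hypothesis intV : forall f s, Cc_pos f ->
  cc_int (fun xi => f (xi + s *: V xi)) = cc_int f.
Hypothesis cQ : continuous (fun xi => 'D_(V xi) u xi).

Local Notation d x := (dist_set x (boundary Omega)).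
Local Notation nu xi := ((eucl_dist (xihat xi) xi)^-1 *: (xihat xi - xi)).
Local Notation Phi s xi := (xi + s *: V xi).
Local Notation Q xi := ('D_(V xi) u xi).
Let K := closure [set x | u x != 0].

Let cu : continuous u.
Proof. by have [/(_ [::])[]] := hu. Qed.

Let du x v : derivable u x v.
Proof. by have [/(_ [::])[]] := hu. Qed.

Let KO : K `<=` Omega. Proof. by have [_ []] := hu. Qed.
Let cK : compact K. Proof. by have [_ []] := hu. Qed.

Let uK x : u x != 0 -> K x.
Proof. by move=> ux; exact: subset_closure. Qed.

Let near_out x : ~ K x -> \forall y \near x, u y = 0.
Proof.
move=> Kx; have : nbhs x (~` K).
  by apply: open_nbhs_nbhs; split => //; apply: closed_openC; exact: closed_closure.
by apply: filterS => y Ky; apply: contrapT => /eqP /uK.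
Qed.

Let cPhi2 (x : 'rV[R]_m) (s : R) :
  Phi p.2 p.1 @[p --> ((x, s) : 'rV[R]_m * R)] --> Phi s x.
Proof.
have Vx : V p.1 @[p --> ((x, s) : 'rV[R]_m * R)] --> V x.
  by apply: (@cvg_comp _ _ _ fst V _ (nbhs x)); [exact: cvg_fst|exact: cV].
exact: (cvgD (@cvg_fst _ _ (nbhs x) (nbhs s) _)
  (cvgZ (@cvg_snd _ _ (nbhs x) (nbhs s) _) Vx)).
Qed.

Let cPhi (s : R) : continuous (fun xi : 'rV[R]_m => Phi s xi).
Proof.
move=> x; have := cvgD (@cvg_id _ (nbhs x)) (cvgZ (@cvg_cst R s _ (nbhs x) _) (@cV x)).
exact.
Qed.

Let PhiNK s x : Phi (- s) (Phi s x) = x.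
Proof. by rewrite flowV scaleNr addrK. Qed.

(** The flow is jointly continuous and is the identity at time 0, so compactness of [A] gives one
    time bound for all its points. *)
Let flow_near (A U : set 'rV[R]_m) : compact A -> open U -> A `<=` U ->
  exists2 e : R, 0 < e & forall s, `|s| < e -> forall x, A x -> U (Phi s x).
Proof.
move=> cA oU AU.
have := cA; rewrite compact_near_coveringP => /(_ R (nbhs 0) (fun s x => U (Phi s x))) H.
have {H}: \forall s \near 0, A `<=` (fun x => U (Phi s x)).
  apply: H => x Ax; apply: (@cPhi2 x 0).
  by apply: open_nbhs_nbhs; split => //; rewrite scale0r addr0; exact: AU.
move=> /nbhs_ballP[e /= e0 He]; exists e => // s se x Ax; apply: (He s) => //.
by rewrite /ball/= sub0r normrN.
Qed.

Let Cc_pos_Phi f s : Cc_pos f -> Cc_pos (fun x => f (Phi s x)).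
Proof.
apply: (@Cc_pos_comp _ _ _ (fun x => Phi s x) (fun x => Phi (- s) x)).
- exact: cPhi.
- exact: cPhi.
- exact: PhiNK.
Qed.

(** The strict inequality puts [K] inside an open ball, to which [flow_near] applies. *)
Let bK : exists B, forall x, K x -> `|x| < B.
Proof.
have [M [_ HM]] := compact_bounded cK.
exists (M + 1 + 1) => x Kx; apply: (@le_lt_trans _ _ (M + 1)); last by rewrite ltrDl.
by apply: (HM (M + 1)); rewrite ?ltrDl.
Qed.

Let Cc_pos_sqr (f : 'rV[R]_m -> R) B :
  continuous f -> (forall x, B < `|x| -> f x = 0) -> Cc_pos (fun x => f x ^+ 2).
Proof.
move=> cf fB; split.
- by move=> x; have := cvgM (cf x) (cf x); exact.
- by move=> x; exact: sqr_ge0.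
- by exists B => x Bx; rewrite fB// expr0n.
Qed.

Let u_out x : ~ K x -> u x = 0.
Proof. by move=> Kx; apply: contrapT => /eqP /uK. Qed.

Lemma Cc_pos_Q2 : Cc_pos (fun x => Q x ^+ 2).
Proof.
have [B HB] := bK; apply: (@Cc_pos_sqr _ B) => // x Bx.
have Kx : ~ K x by move=> /HB; rewrite ltNge (ltW Bx).
rewrite -[RHS](derive_cst (0 : R) x (V x)).
by apply: near_eq_derive; exact: near_out.
Qed.

(** Uniformity over the ball lets one fixed small step replace the limit of difference quotients. *)
Let eps_Q2 (B e : R) : 0 < e -> exists2 r : R, 0 < r & forall s, `|s| < r ->
  forall x, `|x| <= B -> Q (Phi s x) ^+ 2 <= Q x ^+ 2 + e.
Proof.
move=> e0; have := @closed_norm_ball_compact R m B.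
rewrite compact_near_coveringP =>
  /(_ R (nbhs 0) (fun s x => Q (Phi s x) ^+ 2 <= Q x ^+ 2 + e)) H.
have [cQ2 _ _] := Cc_pos_Q2.
have {H}: \forall s \near 0, [set v : 'rV[R]_m | `|v| <= B] `<=`
    (fun x => Q (Phi s x) ^+ 2 <= Q x ^+ 2 + e).
  apply: H => x _.
  have C1 : Q (Phi p.2 p.1) ^+ 2 @[p --> ((x, 0) : 'rV[R]_m * R)] --> Q x ^+ 2.
    have := @cPhi2 x 0; rewrite scale0r addr0 => C.
    apply: (@cvg_comp _ _ _ (fun p : 'rV[R]_m * R => Phi p.2 p.1)
      (fun x => Q x ^+ 2) _ (nbhs x)) C _; exact: cQ2.
  have C2 : Q p.1 ^+ 2 @[p --> ((x, 0) : 'rV[R]_m * R)] --> Q x ^+ 2.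
    by apply: (@cvg_comp _ _ _ fst (fun x => Q x ^+ 2) _ (nbhs x)); [exact: cvg_fst|exact: cQ2].
  have := cvgB C1 C2; rewrite subrr => /(_ _)/cvgr0Pnorm_le/(_ _ e0).
  apply: filterS => p /=.
  by move=> /(le_trans (ler_norm _)); rewrite lerBlDl.
move=> /nbhs_ballP[r /= r0 Hr]; exists r => // s sr x xB; apply: (Hr s) => //.
by rewrite /ball/= sub0r normrN.
Qed.

Let psi x : R := Num.sqrt (d x).
Let quot s x := u x ^+ 2 * (psi (Phi s x) / psi x).

Let d_gt0 x : Omega x -> 0 < d x.
Proof. by move=> Ox; have [bx dx] := hxihat Ox; exact: (dist_boundary_gt0 hopen Ox bx dx). Qed.

Let psi_gt0 x : Omega x -> 0 < psi x.
Proof. by move=> Ox; rewrite sqrtr_gt0 d_gt0. Qed.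

Let cpsi x : Omega x -> {for x, continuous psi}.
Proof.
move=> Ox; apply: (@cvg_comp _ _ _ (fun x => d x) (@Num.sqrt R) _ (nbhs (d x))).
  exact: (dist_boundary_continuous hopen hconv hxihat Ox).
exact: sqrt_continuous.
Qed.

Let Cc_pos_u2 : Cc_pos (fun x => u x ^+ 2).
Proof.
have [B HB] := bK; apply: (@Cc_pos_sqr _ B) => // x Bx.
by apply: u_out => /HB; rewrite ltNge (ltW Bx).
Qed.

(** On [K] the function [psi] is continuous and positive at [x] and at [Phi s x]; off [K] the factor
    [u ^+ 2] is locally zero, whatever [psi] does there. *)
Let Cc_pos_quot s : (forall x, K x -> Omega (Phi s x)) -> Cc_pos (quot s).
Proof.
move=> KPhi; have [cu2 u20 [B HB]] := Cc_pos_u2; split.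
- move=> x; have [Kx|Kx] := pselect (K x).
    have C1 : psi (Phi s y) @[y --> x] --> psi (Phi s x).
      apply: (@cvg_comp _ _ _ (fun y => Phi s y) psi _ (nbhs (Phi s x))).
        exact: cPhi.
      by apply: cpsi; exact: KPhi.
    have C2 : (psi y)^-1 @[y --> x] --> (psi x)^-1.
      have p0 : psi x != 0 by rewrite gt_eqF//; apply: psi_gt0; exact: KO.
      have C := cpsi (KO Kx).
      exact: (cvgV p0 C).
    exact: (cvgM (cu2 x) (cvgM C1 C2)).
  have E : quot s x = 0 by rewrite /quot u_out// expr0n mul0r.
  have N : \forall y \near nbhs x, quot s y = 0.
    by apply: filterS (near_out Kx) => y uy; rewrite /quot uy expr0n mul0r.
  by rewrite /continuous_at E; exact: (@cvg_near_cst _ R 0 (quot s) (nbhs x) (nbhs_filter x) N).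
- by move=> x; rewrite /quot mulr_ge0// divr_ge0// sqrtr_ge0.
- by exists B => x Bx; rewrite /quot HB// mul0r.
Qed.

Let weight x : R := eucl_dot (V x) (nu x) ^+ 2 / d x ^+ 2 * u x ^+ 2.

(** This is the supporting inequality at [Phi h x], divided by [d x]. *)
Let psi_quot_sqr h x : Omega x -> Omega (Phi h x) ->
  (psi (Phi h x) / psi x) ^+ 2 <= 1 - h * eucl_dot (V x) (nu x) / d x.
Proof.
move=> Ox Oh; have d0 := d_gt0 Ox; have dh := d_gt0 Oh.
rewrite exprMn exprVn !sqr_sqrtr ?(ltW d0) ?(ltW dh)//.
have [bx dx] := hxihat Ox.
have := dist_boundary_support hopen hconv Ox bx dx Oh.
rewrite addrAC subrr add0r eucl_dotZl => H.
rewrite ler_pdivrMr// mulrBl mul1r divfK// gt_eqF//.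
Qed.

(** Where [u] vanishes both sides are 0. Elsewhere [sqrt_ratio_ineq] applies to the flow times [h]
    and [- h], and [4 / h ^+ 2] undoes the factor in [q ^+ 2 / 4]. *)
Let weight_le h x : 0 < h -> (forall y, K y -> Omega (Phi h y)) ->
  (forall y, K y -> Omega (Phi (- h) y)) ->
  \1_Omega x * weight x <=
  4 / h ^+ 2 * (2 * u x ^+ 2 - quot h x - quot (- h) x).
Proof.
move=> h0 K1 K2; have [u0|/uK Kx] := eqVneq (u x) 0.
  by rewrite /weight /quot u0 expr0n !mulr0 !mul0r !subr0 mulr0.
have Ox := KO Kx; rewrite indicE mem_set// mul1r.
have h2 : 0 < h ^+ 2 by exact: exprn_gt0.
pose q := h * eucl_dot (V x) (nu x) / d x.
have := @sqrt_ratio_ineq R q (psi (Phi h x) / psi x) (psi (Phi (- h) x) / psi x).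
have H1 := psi_quot_sqr Ox (K1 _ Kx).
have H2 := psi_quot_sqr Ox (K2 _ Kx); rewrite !mulNr opprK in H2.
move=> /(_ _ _ H1 H2) H.
have {}H := H (divr_ge0 (sqrtr_ge0 _) (sqrtr_ge0 _)) (divr_ge0 (sqrtr_ge0 _) (sqrtr_ge0 _)).
rewrite /quot.
have -> : weight x = 4 / h ^+ 2 * (u x ^+ 2 * (q ^+ 2 / 4)).
  rewrite /weight /q; have d0 := d_gt0 Ox; field.
  by rewrite !gt_eqF.
rewrite ler_wpM2l//; first by rewrite divr_ge0// ltW.
apply: (@le_trans _ _ (u x ^+ 2 * (2 - psi (Phi h x) / psi x - psi (Phi (- h) x) / psi x))).
  by rewrite ler_wpM2l// sqr_ge0.
by rewrite le_eqVlt; apply/orP; left; apply/eqP; ring.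
Qed.

(* AM-GM applied to the cross term [2 * u x * u (Phi h x)]. *)
Let u2_shift_le h x : (forall y, K y -> Omega (Phi h y)) ->
  (forall y, K y -> Omega (Phi (- h) y)) ->
  u (Phi h x) ^+ 2 + u x ^+ 2 <=
  (u (Phi h x) - u x) ^+ 2 + (quot h x + quot (- h) (Phi h x)).
Proof.
move=> K1 K2; rewrite /quot PhiNK.
have main : Omega x -> Omega (Phi h x) -> u (Phi h x) ^+ 2 + u x ^+ 2 <=
    (u (Phi h x) - u x) ^+ 2 + (u x ^+ 2 * (psi (Phi h x) / psi x) +
      u (Phi h x) ^+ 2 * (psi x / psi (Phi h x))).
  move=> /psi_gt0 p0 /psi_gt0 p1.
  set a := u x; set b := u (Phi h x); set p := psi x in p0 *; set r := psi (Phi h x) in p1 *.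
  have : 0 <= (a * r - b * p) ^+ 2 / (p * r) by rewrite divr_ge0 ?sqr_ge0// mulr_ge0// ltW.
  have -> : (a * r - b * p) ^+ 2 / (p * r) = a ^+ 2 * (r / p) + b ^+ 2 * (p / r) - 2 * a * b.
    by field; rewrite !gt_eqF.
  by rewrite sqrrB; lra.
have [u0|/uK Kx] := eqVneq (u x) 0; last by apply: main; [exact: KO|exact: K1].
have [uh0|/uK Kh] := eqVneq (u (Phi h x)) 0.
  by rewrite u0 uh0 !expr0n !mul0r subrr expr0n !addr0.
apply: main; last exact: KO.
by have := K2 _ Kh; rewrite PhiNK.
Qed.

(** The majorant [H] lies in [Cc_pos], so bounds for several fields can be added without integrating
    the weights separately. The error [e] absorbs the variation of [Q ^+ 2] along the flow up to a
    fixed time [h]. *)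
Lemma hardy_field (e : R) : 0 < e -> exists2 H : 'rV[R]_m -> R, Cc_pos H &
  (forall x, \1_Omega x * weight x <= H x) /\
  cc_int H <= 4 * cc_int (fun x => Q x ^+ 2) + e.
Proof.
move=> e0; have [B HB] := bK.
pose chi := @cutoff R m B; have chiC : Cc_pos chi := @Cc_pos_cutoff R m B.
have Q2C := Cc_pos_Q2.
have chi0 := cc_int_ge0 chiC.
pose e1 := e / (4 * cc_int chi + 1).
have e10 : 0 < e1 by rewrite divr_gt0//; lra.
have e1e : 4 * (e1 * cc_int chi) <= e.
  rewrite /e1 mulrA (mulrC 4) mulrAC -mulrA mulrAC ler_pdivrMr; last lra.
  by rewrite ler_wpM2l//; [exact: ltW|lra].
have [r1 r10 H1] := flow_near cK hopen KO.
have oB : open [set x : 'rV[R]_m | `|x| < B].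
  have -> : [set x : 'rV[R]_m | `|x| < B] = Num.norm @^-1` [set x | x < B] by [].
  by apply: open_comp; [move=> x _; exact: norm_continuous|exact: open_lt].
have [r2 r20 H2] := flow_near cK oB HB.
have [r3 r30 H3] := @eps_Q2 B e1 e10.
(* Three constraints on the step: [K] stays in [Omega], [K] stays in the ball, and [Q ^+ 2] grows by
   at most [e1]. *)
pose r := Num.min r1 (Num.min r2 r3).
have r0 : 0 < r by rewrite !lt_min r10 r20 r30.
pose h := r / 2.
have h0 : 0 < h by exact: divr_gt0.
have hr : `|h| < r by rewrite gtr0_norm// /h; lra.
have K1 y : K y -> Omega (Phi h y).
  by move=> Ky; apply: H1 => //; apply: lt_le_trans hr _; rewrite /r ge_min lexx.
have K2 y : K y -> Omega (Phi (- h) y).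
  by move=> Ky; apply: H1; rewrite ?normrN//; apply: lt_le_trans hr _; rewrite /r ge_min lexx.
(* Since [Phi (- h)] inverts [Phi h], this makes [u (Phi h x)] vanish outside the ball of radius
   [B]. *)
have K3 y : K y -> `|Phi (- h) y| < B.
  move=> Ky; apply: H2; rewrite ?normrN//; apply: lt_le_trans hr _.
  by rewrite /r !ge_min lexx !orbT.
pose G x := 2 * u x ^+ 2 - quot h x - quot (- h) x.
have h2 : 0 < h ^+ 2 by exact: exprn_gt0.
have q1C := Cc_pos_quot K1; have q2C := Cc_pos_quot K2.
have GC : Cc_pos G.
  have [cu2 _ [C HC]] := Cc_pos_u2; have [cq1 _ _] := q1C; have [cq2 _ _] := q2C.
  split.
  - move=> x.
    have := cvgB (cvgB (cvgM (@cvg_cst R 2 _ (nbhs x) _) (cu2 x)) (cq1 x)) (cq2 x).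
    exact.
  - move=> x.
    (* Nonnegativity of the difference [G] is inherited from the weight it dominates. *)
    have := weight_le x h0 K1 K2; rewrite -/(G x) => H.
    rewrite -(@pmulr_rge0 _ (4 / h ^+ 2)) ?divr_gt0//.
    apply: le_trans H; rewrite mulr_ge0 ?indicE ?ler0n// /weight mulr_ge0 ?sqr_ge0//.
    by rewrite divr_ge0 ?sqr_ge0.
  - by exists C => x Cx; rewrite /G /quot HC// !mul0r mulr0 !subr0.
have DC : Cc_pos (fun x => (u (Phi h x) - u x) ^+ 2).
  have uhC := @Cc_pos_Phi _ h Cc_pos_u2.
  have [_ _ [C1 HC1]] := Cc_pos_u2; have [_ _ [C2 HC2]] := uhC.
  apply: (@Cc_pos_sqr _ (Num.max C1 C2)).
    move=> x; have C : u (Phi h y) @[y --> x] --> u (Phi h x).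
      by apply: (@cvg_comp _ _ _ (fun y => Phi h y) u _ (nbhs (Phi h x)));
        [exact: cPhi|exact: cu].
    exact: (cvgB C (@cu x)).
  move=> x; rewrite gt_max => /andP[/HC1/eqP + /HC2/eqP].
  by rewrite !sqrf_eq0 => /eqP-> /eqP->; rewrite subrr.
(* In the ball, the mean value theorem is applied along an integral line, where the derivative is
   [Q] at the intermediate point; outside it both values of [u] vanish. *)
have DQ x : (u (Phi h x) - u x) ^+ 2 <= h ^+ 2 * (Q x ^+ 2 + e1 * chi x).
  have chix : 0 <= chi x by case: chiC.
  have [xB|xB] := leP `|x| B.
    have [t th E] := line_MVT x h (fun y => @du y (V x)).
    rewrite E exprMn ler_wpM2l ?sqr_ge0//.
    have -> : 'D_(V x) u (Phi t x) = Q (Phi t x) by rewrite flowV.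
    apply: (@le_trans _ _ (Q x ^+ 2 + e1)).
      apply: H3 => //; apply: (le_lt_trans th); apply: lt_le_trans hr _.
      by rewrite /r !ge_min lexx !orbT.
    by rewrite lerD2l ler_peMr ?(ltW e10)//; exact: cutoff_ge1.
  have -> : u x = 0 by apply: u_out => /HB; rewrite ltNge (ltW xB).
  have -> : u (Phi h x) = 0.
    by apply: u_out => /K3; rewrite PhiNK ltNge (ltW xB).
  rewrite subrr expr0n mulr_ge0 ?sqr_ge0// addr_ge0 ?sqr_ge0// mulr_ge0//; exact: ltW.
exists (fun x => 4 / h ^+ 2 * G x); first by apply: Cc_posZ => //; rewrite divr_ge0// ltW.
split; first by move=> x; exact: weight_le.
rewrite cc_intZ//; last by rewrite divr_ge0// ltW.
(* [cc_int] is additive on nonnegative functions only, so the subtracted terms are moved to the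
   other side. *)
have IG : cc_int G + (cc_int (quot h) + cc_int (quot (- h))) =
    cc_int (fun x => u x ^+ 2) + cc_int (fun x => u x ^+ 2).
  rewrite -!cc_intD//; last exact: Cc_posD.
  by congr cc_int; apply/funext => x; rewrite /G; ring.
have IU : cc_int (fun x => u x ^+ 2) + cc_int (fun x => u x ^+ 2) <=
    cc_int (fun x => (u (Phi h x) - u x) ^+ 2) + (cc_int (quot h) + cc_int (quot (- h))).
  (* One copy of the integral of [u ^+ 2] and the integral of [quot (- h)] are transported by
     [Phi h]; the integrands then compare pointwise. *)
  rewrite -{1}(intV h Cc_pos_u2) -(intV h q2C) -!cc_intD//; try exact: Cc_pos_Phi.
    apply: le_cc_int.
    - by apply: Cc_posD => //; exact: (@Cc_pos_Phi _ h Cc_pos_u2).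
    - by apply: Cc_posD => //; apply: Cc_posD => //; exact: Cc_pos_Phi.
    - by move=> x; exact: u2_shift_le.
  - by apply: Cc_posD => //; exact: Cc_pos_Phi.
  - exact: (@Cc_pos_Phi _ h Cc_pos_u2).
have ID : cc_int (fun x => (u (Phi h x) - u x) ^+ 2) <=
    h ^+ 2 * (cc_int (fun x => Q x ^+ 2) + e1 * cc_int chi).
  have chiC1 : Cc_pos (fun x => e1 * chi x) by apply: Cc_posZ => //; exact: ltW.
  rewrite -(@cc_intZ _ _ e1)//; last exact: ltW.
  rewrite -cc_intD// -cc_intZ ?(ltW h2)//; last exact: Cc_posD.
  apply: le_cc_int => //; apply: Cc_posZ; [exact: ltW|exact: Cc_posD].
have : cc_int G <= h ^+ 2 * (cc_int (fun x => Q x ^+ 2) + e1 * cc_int chi) by lra.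
move=> /(ler_wpM2l (_ : 0 <= 4 / h ^+ 2)) => /(_ (divr_ge0 (ler0n _ 4) (ltW h2))).
by rewrite (mulrA (4 / _)) divfK ?gt_eqF//; lra.
Qed.

End HardyField.

(** * The Heisenberg fields as shear fields *)

Section ShearField.
Context {R : realType} {m : nat} (a b t : 'I_m) (k : R).
Hypotheses (ab : a != b) (lt_at : (a < t)%N) (lt_bt : (b < t)%N).

(** Common form of both families: [k = 2] gives [Xvf], while [k = - 2] with the two horizontal
    indices exchanged gives [Yvf]. *)
Definition shear_field (xi : 'rV[R]_m) : 'rV[R]_m :=
  delta_mx 0 a + (k * xi 0 b) *: delta_mx 0 t.

Lemma shear_field_continuous : continuous shear_field.
Proof.
move=> xi; rewrite /continuous_at /shear_field.
have C := @coord_continuous R 1 m 0 b xi.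
have := cvgD (@cvg_cst 'rV[R]_m (delta_mx 0 a) _ (nbhs xi) _)
  (cvgZ (cvgM (@cvg_cst R k _ (nbhs xi) _) C) (@cvg_cst 'rV[R]_m (delta_mx 0 t) _ (nbhs xi) _)).
exact.
Qed.

(** The flow moves only the coordinates [a] and [t], and the field depends only on coordinate
    [b]. *)
Lemma shear_field_flow (xi : 'rV[R]_m) s :
  shear_field (xi + s *: shear_field xi) = shear_field xi.
Proof.
congr (_ + (_ * _) *: _); rewrite !mxE /= eq_sym (negbTE ab) add0r.
by rewrite (ltn_eqF lt_bt : (b == t) = false) !mulr0 addr0.
Qed.

(** The flow is a translation along [a] and a shear along [t] with displacement proportional to
    coordinate [b]. Since [b] is integrated outside [t], [leb_int_shear] removes each in turn. *)
Lemma cc_int_shear_field (f : 'rV[R]_m -> R) s : Cc_pos f ->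
  cc_int (fun xi => f (xi + s *: shear_field xi)) = cc_int f.
Proof.
move=> fC; congr fine.
pose g (xi : 'rV[R]_m) := f (xi + (s * k * xi 0 b) *: delta_mx 0 t).
have gC : Cc_pos g.
  have cphi (c : R) : continuous (fun xi : 'rV[R]_m => xi + (c * xi 0 b) *: delta_mx 0 t).
    move=> xi; have C := @coord_continuous R 1 m 0 b xi.
    have := cvgD (@cvg_id _ (nbhs xi)) (cvgZ (cvgM (@cvg_cst R c _ (nbhs xi) _) C)
      (@cvg_cst 'rV[R]_m (delta_mx 0 t) _ (nbhs xi) _)).
    exact.
  apply: (@Cc_pos_comp _ _ f _ _ (cphi (s * k)) (cphi (- (s * k)))) => // xi.
  rewrite !mxE /= (ltn_eqF lt_bt : (b == t) = false) mulr0 addr0.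
  by rewrite mulNr scaleNr addrK.
transitivity (leb_int (fun xi => (g (xi + s *: delta_mx 0 a))%:E)).
  congr leb_int; apply/funext => xi; congr ((f _)%:E).
  rewrite /shear_field !mxE /= eq_sym (negbTE ab) mulr0 addr0.
  by rewrite scalerDr scalerA addrA mulrA.
rewrite (@leb_int_shear R m a (fun=> s) g)//.
rewrite (@leb_int_shear R m t (fun xi => s * k * xi 0 b) f)// => v w vw.
by rewrite vw.
Qed.

Lemma derive_shear_field (u : 'rV[R]_m -> R) (xi : 'rV[R]_m) : smooth u ->
  'D_(shear_field xi) u xi = 'D_(delta_mx 0 a) u xi + k * xi 0 b * 'D_(delta_mx 0 t) u xi.
Proof.
move=> su; apply: deriveDZ; first by case: (su [::]).
by have [+ _] := su [:: delta_mx 0 t]; apply.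
Qed.

Lemma derive_shear_field_continuous (u : 'rV[R]_m -> R) : smooth u ->
  continuous (fun xi => 'D_(shear_field xi) u xi).
Proof.
move=> su; under eq_fun do rewrite derive_shear_field//.
move=> xi; have C := @coord_continuous R 1 m 0 b xi.
have [/(_ xi) Ca _] := su [:: delta_mx 0 a].
have [/(_ xi) Ct _] := su [:: delta_mx 0 t].
have := cvgD Ca (cvgM (cvgM (@cvg_cst R k _ (nbhs xi) _) C) Ct); exact.
Qed.

End ShearField.

(** * Summation over the fields *)

Theorem theorem3p1 (R : realType) (n : nat) (Omega : set (pt R n))
  (hopen : open Omega) (hconv : econvex Omega)
  (hne : Omega !=set0) (hproper : Omega <> setT)
  (xihat : pt R n -> pt R n)
  (hxihat : forall xi, Omega xi ->
     boundary Omega (xihat xi) /\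
     eucl_dist xi (xihat xi) = dist_set xi (boundary Omega))
  (u : pt R n -> R) (hu : Cc_infty Omega u) :
  let nu xi := (eucl_dist (xihat xi) xi)^-1 *: (xihat xi - xi) in
  (leb_int (fun xi => (gradH_sq u xi)%:E) >=
   (4^-1)%:E * leb_int (fun xi =>
     (\1_Omega xi *
      ((\sum_(i < n) (eucl_dot (Xvf i xi) (nu xi) ^+ 2 + eucl_dot (Yvf i xi) (nu xi) ^+ 2))
        / dist_set xi (boundary Omega) ^+ 2 * u xi ^+ 2))%:E))%E.
Proof.
pose nu (xi : pt R n) : pt R n := (eucl_dist (xihat xi) xi)^-1 *: (xihat xi - xi).
have su : smooth u by case: hu.
have XE (i : 'I_n) : Xvf (R := R) i = shear_field (ix i) (iy i) (it n) 2 by [].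
have YE (i : 'I_n) : Yvf (R := R) i = shear_field (iy i) (ix i) (it n) (- 2).
  by apply/funext => xi; rewrite /Yvf /shear_field mulNr scaleNr.
have ix_it (i : 'I_n) : (ix i < it n)%N by rewrite /= addn0 ltn_addr.
have iy_it (i : 'I_n) : (iy i < it n)%N by rewrite /= addn0 ltn_add2l.
have ixy (i : 'I_n) : ix i != iy i by rewrite -val_eqE /= neq_ltn ltn_addr.
have iyx (i : 'I_n) : iy i != ix i by rewrite eq_sym ixy.
pose wt (W : pt R n -> pt R n) xi :=
  eucl_dot (W xi) (nu xi) ^+ 2 / dist_set xi (boundary Omega) ^+ 2 * u xi ^+ 2.
have hardy (a b : 'I_(dimH n)) (k : R) (P : pt R n -> R) : a != b -> (a < it n)%N -> (b < it n)%N ->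
    (forall xi, 'D_(shear_field a b (it n) k xi) u xi = P xi) ->
    Cc_pos (fun xi => P xi ^+ 2) /\
    forall e : R, 0 < e -> exists2 H : pt R n -> R, Cc_pos H &
      (forall xi, \1_Omega xi * wt (shear_field a b (it n) k) xi <= H xi) /\
      cc_int H <= 4 * cc_int (fun xi => P xi ^+ 2) + e.
  move=> ab lt_at lt_bt PE.
  have <- : (fun xi => 'D_(shear_field a b (it n) k xi) u xi ^+ 2) = (fun xi => P xi ^+ 2).
    by apply/funext => xi; rewrite PE.
  have cQ := @derive_shear_field_continuous R _ a b (it n) k u su.
  split; first exact: (Cc_pos_Q2 hu cQ).
  move=> e; apply: (hardy_field hopen hconv hxihat hu) => //.
  - exact: shear_field_continuous.
  - by move=> xi s; exact: shear_field_flow.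
  - by move=> f s; exact: cc_int_shear_field.
have hX (i : 'I_n) := hardy _ _ 2 (Xop i u) (ixy i) (ix_it i) (iy_it i)
  (fun xi => @derive_shear_field R _ (ix i) (iy i) (it n) 2 u xi su).
have YQ (i : 'I_n) xi : 'D_(shear_field (iy i) (ix i) (it n) (- 2) xi) u xi = Yop i u xi.
  by rewrite derive_shear_field// !mulNr.
have hY (i : 'I_n) := hardy _ _ (- 2) (Yop i u) (iyx i) (iy_it i) (ix_it i) (YQ i).
pose P i xi := Xop i u xi ^+ 2 + Yop i u xi ^+ 2.
have PC i : Cc_pos (P i) by apply: Cc_posD; [case: (hX i)|case: (hY i)].
have gradE : gradH_sq u = (fun xi => \sum_(i < n) P i xi) by [].
have gradC : Cc_pos (gradH_sq u) by rewrite gradE; exact: Cc_pos_sum.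
pose F xi := \1_Omega xi *
  ((\sum_(i < n) (eucl_dot (Xvf i xi) (nu xi) ^+ 2 + eucl_dot (Yvf i xi) (nu xi) ^+ 2))
    / dist_set xi (boundary Omega) ^+ 2 * u xi ^+ 2).
have F0 xi : 0 <= F xi.
  rewrite /F mulr_ge0 ?indicE ?ler0n// mulr_ge0 ?sqr_ge0// divr_ge0 ?sqr_ge0//.
  by apply: sumr_ge0 => i _; rewrite addr_ge0 ?sqr_ge0.
have FE xi : F xi = \sum_(i < n) (\1_Omega xi * wt (Xvf i) xi + \1_Omega xi * wt (Yvf i) xi).
  rewrite /F !mulr_suml mulr_sumr; apply: eq_bigr => i _.
  by rewrite -mulrDr -mulrDl -mulrDl.
have bound (e : R) : 0 < e ->
    (leb_int (fun xi => (F xi)%:E) <= (4 * cc_int (gradH_sq u) + e)%:E)%E.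
  (* Each of the [2 * n] fields contributes an error [e1]; the added 1 keeps the denominator
     positive when [n = 0]. *)
  move=> e0; pose e1 := e / (2 * n%:R + 1).
  have n1 : 0 < 2 * n%:R + 1 :> R by rewrite ltr_wpDl// mulr_ge0.
  have e10 : 0 < e1 by rewrite divr_gt0.
  have /choice[H HP] (i : 'I_n) : exists H : pt R n -> R, [/\ Cc_pos H,
      forall xi, \1_Omega xi * wt (Xvf i) xi + \1_Omega xi * wt (Yvf i) xi <= H xi &
      cc_int H <= 4 * cc_int (P i) + 2 * e1].
    have [QX /(_ _ e10)[H1 H1C [H1F H1I]]] := hX i.
    have [QY /(_ _ e10)[H2 H2C [H2F H2I]]] := hY i.
    exists (fun xi => H1 xi + H2 xi); split; first exact: Cc_posD.
      by move=> xi; rewrite XE YE lerD.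
    by rewrite cc_intD// /P cc_intD//; lra.
  have HC i : Cc_pos (H i) by case: (HP i).
  (* Only monotonicity is used for [F]; additivity is applied to the majorants [H i]. *)
  apply: (@le_trans _ _ (leb_int (fun xi => (\sum_(i < n) H i xi)%:E))).
    apply: le_leb_int => xi; rewrite lee_fin ?F0// FE.
    by apply: ler_sum => i _; case: (HP i).
  rewrite cc_intE; last exact: Cc_pos_sum.
  rewrite lee_fin cc_int_sum// gradE cc_int_sum//.
  apply: (@le_trans _ _ (\sum_(i < n) (4 * cc_int (P i) + 2 * e1))).
    by apply: ler_sum => i _; case: (HP i).
  rewrite big_split/= -mulr_sumr lerD2l sumr_const card_ord -mulr_natl.
  have : e1 * (2 * n%:R + 1) = e by rewrite /e1 divfK// gt_eqF.
  by lra.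
change ((4^-1)%:E * leb_int (fun xi => (F xi)%:E) <= leb_int (fun xi => (gradH_sq u xi)%:E))%E.
rewrite (cc_intE gradC).
(* Finiteness, from the bound with error 1, turns the goal into an inequality of reals, where [e]
   can tend to 0. *)
have Ffin : leb_int (fun xi => (F xi)%:E) \is a fin_num.
  rewrite ge0_fin_numE; last by apply: leb_int_ge0 => xi; rewrite lee_fin.
  exact: le_lt_trans (bound 1 ltr01) (ltry _).
rewrite -[X in ((4^-1)%:E * X <= _)%E](fineK Ffin) -EFinM lee_fin.
rewrite mulrC ler_pdivrMr// mulrC; apply/ler_addgt0Pr => e e0.
by rewrite -lee_fin fineK//; exact: bound.
Qed.
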